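(* Let $0<\alpha<1$ and let $X$ be a compact locally $\mathrm{SRA}(\alpha)$-free metric space. Then $X$ is $\mathrm{SRA}(\alpha)$-free.
   Context: For $0<\alpha<1$, a metric space $(Y,d)$ satisfies the $\mathrm{SRA}(\alpha)$ condition if for all $x,y,z\in Y$, $d(x,y)\le\max\{d(x,z)+\alpha d(z,y),\ \alpha d(x,z)+d(z,y)\}$. For $k\in\mathbb{N}$, a metric space $X$ is free of $k$-point $\mathrm{SRA}(\alpha)$ subspaces if no $k$-point subset $Y\subset X$ (with the induced metric) satisfies the $\mathrm{SRA}(\alpha)$ condition. $X$ is $\mathrm{SRA}(\alpha)$-free if it is free of $k$-point $\mathrm{SRA}(\alpha)$ subspaces for some $k\in\mathbb{N}$. $X$ is locally $\mathrm{SRA}(\alpha)$-free if for every $x\in X$ there is $r>0$ such that the open ball $B_r(x)$, with the metric induced from $X$, is $\mathrm{SRA}(\alpha)$-free. *)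

(* Defs.v *)
From HB Require Import structures.
From mathcomp Require Import all_boot all_order all_algebra.
From mathcomp Require Import all_classical all_reals all_analysis.

Set Implicit Arguments.
Unset Strict Implicit.
Unset Printing Implicit Defensive.

Import Order.TTheory GRing.Theory Num.Theory.

Local Open Scope classical_set_scope.
Local Open Scope card_scope.
Local Open Scope ring_scope.

(* A metric subspace of X is represented by its carrier Y : set X; its induced
   metric is the restriction of mdist to Y. *)

Definition SRA (R : realType) (X : metricType R) (alpha : R) (Y : set X) : Prop :=
  forall x y z : X, Y x -> Y y -> Y z ->
    mdist x y <= Num.max (mdist x z + alpha * mdist z y)
                         (alpha * mdist x z + mdist z y).

Definition free_of_SRA_subspaces (R : realType) (X : metricType R)
    (k : nat) (alpha : R) (S : set X) : Prop :=
  forall Y : set X, Y `<=` S -> Y #= `I_k -> ~ SRA alpha Y.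

Definition SRA_free (R : realType) (X : metricType R) (alpha : R)
    (S : set X) : Prop :=
  exists k : nat, free_of_SRA_subspaces k alpha S.

Definition locally_SRA_free (R : realType) (X : metricType R) (alpha : R) : Prop :=
  forall x : X, exists r : R, 0 < r /\ SRA_free alpha (ball x r).

(* Main.v *)
Require Import Defs.
From HB Require Import structures.
From mathcomp Require Import all_boot all_order all_algebra.
From mathcomp Require Import all_classical all_reals all_analysis.
From mathcomp Require Import finmap.

Import Order.TTheory GRing.Theory Num.Theory.

Local Open Scope classical_set_scope.
Local Open Scope ring_scope.

(** Freeness passes to subsets and, by pigeonhole, to finite unions: a subset
    of [A `|` B] with [a + b] points has [a] points in [A] or [b] points in
    [B], and the SRA condition is inherited by subsets. Hence the complements
    of the SRA-free sets form a filter. If [X] were not SRA-free, this filter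
    would be proper, and by compactness it would have a cluster point; but every
    point has an SRA-free neighbourhood, whose complement is in the filter. *)

Local Open Scope card_scope.

Lemma card_set_seq (T : choiceType) (s : seq T) :
  uniq s -> [set` s] #= `I_(size s).
Proof.
move=> s_uniq; have -> : [set` s] = [set` [fset x in s]%fset].
  by apply/seteqP; split=> x /=; rewrite in_fset.
by apply/card_eq_fsetP; rewrite card_fseq undup_id.
Qed.

(** Freeness concerns subsets with exactly [k] points, so a lower bound on a count is turned into an
    exact cardinality by truncating the filtered list. *)
Lemma subset_card_filter {T : choiceType} {s : seq T} {p : pred T} {n : nat} :
  uniq s -> (n <= count p s)%N ->
  exists2 Z : set T, Z `<=` [set x : T | x \in s /\ p x] & Z #= `I_n.
Proof.
move=> s_uniq le_n; exists [set` take n [seq x <- s | p x]].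
  by move=> x /= /mem_take; rewrite mem_filter => /andP[].
rewrite -[n in `I_n](@size_takel n _ [seq x <- s | p x]) ?size_filter//.
by apply: card_set_seq; rewrite take_uniq ?filter_uniq.
Qed.

Lemma subset_setU_card {T : choiceType} {A B Y : set T} {a b : nat} :
  Y `<=` A `|` B -> Y #= `I_(a + b) ->
  (exists2 Z, Z `<=` Y `&` A & Z #= `I_a) \/
  (exists2 Z, Z `<=` Y `&` B & Z #= `I_b).
Proof.
move=> YAB cardY; set s : seq T := fset_set Y.
have finY : finite_set Y by apply/finite_setP; exists (a + b)%N.
have sY x : x \in s -> Y x by rewrite in_fset_set//; exact: set_mem.
have s_uniq : uniq s by exact: fset_uniq.
have size_s : size s = (a + b)%N by exact: card_fset_set.
have [le_a|lt_a] := leqP a (count (mem A) s).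
  left; have [Z ZsA cardZ] := subset_card_filter s_uniq le_a.
  by exists Z => // x /ZsA[/sY Yx] /set_mem Ax.
(* Fewer than [a] of the [a + b] points lie in [A], so at least [b] lie outside [A], hence in
   [B]. *)
right; have le_b : (b <= count (predC (mem A)) s)%N.
  by rewrite -(leq_add2l a) -size_s -(count_predC (mem A) s) leq_add2r ltnW.
have [Z ZsB cardZ] := subset_card_filter s_uniq le_b.
exists Z => // x /ZsB[/sY Yx] /negP nAx; split=> //.
by case: (YAB x Yx) => // Ax; case: nAx; exact: mem_set.
Qed.

Section SRA_free_theory.
Context {R : realType} {X : metricType R} {alpha : R}.
Implicit Types A B : set X.

Lemma SRA_subset A B : A `<=` B -> SRA alpha B -> SRA alpha A.
Proof. by move=> AB sB x y z /AB Bx /AB By /AB Bz; exact: sB. Qed.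

Lemma SRA_free_subset A B : A `<=` B -> SRA_free alpha B -> SRA_free alpha A.
Proof. by move=> AB [k kB]; exists k => Y /subset_trans/(_ AB); exact: kB. Qed.

Lemma SRA_free_set0 : SRA_free alpha (set0 : set X).
(* The witness 0 would fail: the empty subset satisfies the SRA condition vacuously. *)
Proof. by exists 1%N => Y; rewrite subset0 => -> /eq_cardSP[x []]. Qed.

Lemma SRA_free_setU A B :
  SRA_free alpha A -> SRA_free alpha B -> SRA_free alpha (A `|` B).
Proof.
move=> [a freeA] [b freeB]; exists (a + b)%N => Y YAB cardY sraY.
have [[Z]|[Z]] := subset_setU_card YAB cardY;
  rewrite subsetI => -[ZY ZS] cardZ.
- exact: freeA ZS cardZ (SRA_subset _ _ ZY sraY).
- exact: freeB ZS cardZ (SRA_subset _ _ ZY sraY).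
Qed.

Lemma co_SRA_free_filter : Filter [set S : set X | SRA_free alpha (~` S)].
Proof.
split=> /=.
- by rewrite setCT; exact: SRA_free_set0.
- by move=> P Q; rewrite /= setCI; exact: SRA_free_setU.
- by move=> P Q /subsetC; exact: SRA_free_subset.
Qed.

End SRA_free_theory.

Theorem theorem5 (R : realType) (X : metricType R) (alpha : R)
    (halpha : 0 < alpha < 1)
    (hcompact : compact [set: X])
    (hlocal : locally_SRA_free X alpha) :
  SRA_free alpha [set: X].
Proof.
apply: contrapT => nfreeX.
have F_proper : ProperFilter [set S : set X | SRA_free alpha (~` S)].
  apply: Build_ProperFilter_ex; last exact: co_SRA_free_filter.
  (* An empty member of the filter would have the whole space as its SRA-free complement, against
     [nfreeX]. *)
  move=> S freeCS; apply/set0P; apply/eqP => S0.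
  by apply: nfreeX; rewrite -setC0 -S0.
have [|x [_ clx]] := hcompact _ F_proper.
  by rewrite /= setCT; exact: SRA_free_set0.
have [r [r0 freeB]] := hlocal x.
(* A cluster point makes every member of the filter meet every neighbourhood of [x], here a ball and
   its own complement. *)
have [y [nBy By]] : ~` ball x r `&` ball x r !=set0.
  by apply: clx; [rewrite /= setCK | exact: nbhsx_ballx].
exact: nBy.
Qed.
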